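(* Let $k\ge 2$ and let $G$ be a minimally $k$-connected graph with $n$ vertices and $m$ edges. Then $$|V_k|=\frac{m-n+c_F+|E_k|}{k-1}.$$ In particular, $$|V_k|\ge\left\lceil\frac{m-n+k}{k-1}\right\rceil.$$
   Context: All graphs are finite, simple and undirected. A $k$-separator is a set of $k\ge 0$ vertices whose deletion leaves a disconnected graph. A graph is $k$-connected if it has more than $k$ vertices and contains no $(k-1)$-separator. A $k$-connected graph $G$ is minimally $k$-connected if $G-e$ is not $k$-connected for every edge $e$. For a graph $G$: $V_k$ is the set of vertices of degree exactly $k$; $E_k$ is the set of edges of $G$ with both end vertices in $V_k$; $F:=G-V_k$ is the graph obtained by deleting $V_k$; and $c_F$ is the number of connected components of $F$. *)

(* Defs.v *)
From HB Require Import structures.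
From mathcomp Require Import all_boot all_order all_algebra.
Set Implicit Arguments. Unset Strict Implicit. Unset Printing Implicit Defensive.

Section Graphs.
Variable T : finType.

Definition simple_graph (g : rel T) : Prop := symmetric g /\ irreflexive g.

Definition edges (g : rel T) : {set {set T}} :=
  [set [set x; y] | x in T, y in T & g x y].

Definition del_rel (g : rel T) (S : {set T}) : rel T :=
  [rel x y | g x y && (x \notin S) && (y \notin S)].

Definition disconnected_after (g : rel T) (S : {set T}) : Prop :=
  exists x y, [/\ x \notin S, y \notin S & ~~ connect (del_rel g S) x y].

Definition separator (g : rel T) (j : nat) (S : {set T}) : Prop :=
  #|S| = j /\ disconnected_after g S.

Definition k_connected (g : rel T) (k : nat) : Prop :=
  k < #|T| /\ ~ (exists S : {set T}, separator g k.-1 S).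

Definition del_edge (g : rel T) (u v : T) : rel T :=
  [rel x y | g x y && ~~ (((x == u) && (y == v)) || ((x == v) && (y == u)))].

Definition minimally_k_connected (g : rel T) (k : nat) : Prop :=
  k_connected g k /\ (forall u v, g u v -> ~ k_connected (del_edge g u v) k).

Definition deg (g : rel T) (x : T) : nat := #|[set y | g x y]|.

Definition Vdeg (g : rel T) (k : nat) : {set T} := [set x | deg g x == k].

Definition Edeg (g : rel T) (k : nat) : {set {set T}} :=
  [set E in edges g | E \subset Vdeg g k].

Definition cF (g : rel T) (k : nat) : nat :=
  n_comp (del_rel g (Vdeg g k)) (~: Vdeg g k).

End Graphs.

(* Main.v *)
Require Import Defs.
From HB Require Import structures.
From mathcomp Require Import all_boot all_order all_algebra.
From mathcomp Require Import zify lra.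
Set Implicit Arguments. Unset Strict Implicit. Unset Printing Implicit Defensive.
Import Order.TTheory GRing.Theory Num.Theory.

(** Let F = G - V_k. For a critical edge xy write V = A + S + B with x in A,
    y in B, |S| < k and xy the only A-B edge. If deg y > k and (A', S', B') is
    such a partition for a further edge yz, comparing the boundaries of the four
    corners gives that A and B' are disjoint and |B'| < |B|. So an edge of F
    inside a vertex set X with |B| minimal ends in a leaf y of F[X], hence F is a
    forest (Mader), and counting the edges of G by their ends in V_k gives the
    formula.

    For the bound one needs k <= c_F + |E_k|, which holds as soon as some v in
    V_k has all its neighbours outside V_k in distinct components of F. Choose an
    edge xy of F with |B| minimal and v in B with deg v = k. If two neighbours
    of v are joined by a path of F whose edges have partitions with v outside S,
    moving along the path yields a contradiction. Uncrossing a partition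
    (A', S', B') of an edge of F with (A, S, B) makes S' avoid v, unless B is
    contained in S' and 2|B| < k; in that case either two vertices of B in V_k
    already provide k edges of E_k, or S lies in V_k and the path is confined
    to B. *)

(** * Counting in forests *)

Section Counting.
Variable T : finType.
Implicit Types (e : rel T) (X D : {set T}).

Lemma del_rel_sym e D : symmetric e -> symmetric (del_rel e D).
Proof. by move=> se u v; rewrite /del_rel /= se andbAC. Qed.

Lemma del_rel_simple e D : simple_graph e -> simple_graph (del_rel e D).
Proof. by case=> se ie; split=> [|u]; [apply: del_rel_sym | rewrite /del_rel /= ie]. Qed.

Lemma handshake e : simple_graph e -> \sum_x deg e x = 2 * #|edges e|.
Proof.
move=> [se ie]; pose P := [set p : T * T | e p.1 p.2].
have -> : \sum_x deg e x = #|P|.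
  rewrite -sum1dep_card (eq_bigl (fun p : T * T => e p.1 p.2)) //.
  rewrite -(pair_big_dep xpredT e (fun _ _ => 1)) /=.
  by apply: eq_bigr => x _; rewrite sum1dep_card.
pose f (p : T * T) := [set p.1; p.2].
have -> : edges e = f @: P.
  apply/setP=> E; apply/imset2P/imsetP => [[x y _ yP ->]|[[x y] pP ->]].
    by exists (x, y) => //; move: yP; rewrite !inE.
  by exists x y; rewrite ?inE //; move: pP; rewrite !inE.
(* The fibre of [f] over an edge consists of its two orientations. *)
rewrite -sum1_card (partition_big_imset f) /= mulnC -sum_nat_const.
apply: eq_bigr => _ /imsetP[[x y]] /[!inE] /= exy ->.
have xy : x != y by apply: contraTneq exy => ->; rewrite ie.
rewrite sum1dep_card -[RHS](_ : #|[set (x, y); (y, x)]| = 2); last first.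
  by rewrite cards2 xpair_eqE negb_and xy.
apply: eq_card => -[u v]; rewrite !inE /f /= !xpair_eqE.
apply/andP/orP => [[euv /eqP E]|]; last first.
  case=> /andP[/eqP-> /eqP->]; first by rewrite exy eqxx.
  by rewrite se exy setUC eqxx.
have uv : u != v by apply: contraTneq euv => ->; rewrite ie.
have /set2P ux : u \in [set x; y] by rewrite -E !inE eqxx.
have /set2P vx : v \in [set x; y] by rewrite -E !inE eqxx orbT.
by case: ux vx uv => -> [] ->; rewrite ?eqxx //= => _; auto.
Qed.

Lemma n_comp_isolated e (a : {pred T}) :
  connect_sym e -> (forall u v, u \in a -> ~~ e u v) -> n_comp e a = #|a|.
Proof.
move=> se iso; apply: eq_card => u; rewrite !inE andb_idl // => ua.
have /connectP[[|v p] /= ]: connect e u (fingraph.root e u) by apply: connect_root.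
  by move=> _ E; rewrite /roots /= E.
by rewrite (negPf (iso _ _ ua)).
Qed.

(* Collapsing the pendant vertex y onto its neighbour x is an adjunction, which
   shows that the components of e' are those of e other than {y}. *)
Lemma n_comp_pendant e e' x y :
  symmetric e -> symmetric e' -> (forall v, ~~ e y v) -> y != x ->
  (forall u v, e' u v =
     [|| e u v, (u == x) && (v == y) | (u == y) && (v == x)]) ->
  n_comp e T = (n_comp e' T).+1.
Proof.
move=> /sym_connect_sym se /[dup] syme' /sym_connect_sym se' iso yx e'E.
have sube : subrel (connect e) (connect e').
  by apply: connect_sub => u v euv; apply: connect1; rewrite e'E euv.
have cl : closed e (pred1 y).
  apply: (intro_closed se) => u v euv /eqP uy.
  by move: euv; rewrite uy (negPf (iso v)).
rewrite (n_compC (pred1 y)) n_comp_isolated ?card1 //; last first.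
  by move=> u v /eqP->.
congr (_.+1).
pose h u := if u == y then x else u.
have hy u : h u != y by rewrite /h; case: (eqVneq u y) => //; rewrite eq_sym.
have uh u : connect e' u (h u).
  by rewrite /h; case: eqP => // ->; rewrite connect1 // e'E !eqxx !orbT.
have ad : rel_adjunction h e e' [predC pred1 y].
  split=> [u|u v _].
    by rewrite !inE => uy; exists u; rewrite /h (negPf uy) connect0.
  apply/idP/idP => [/connectP[p pp ->{v}]|/sube huv]; last first.
    by apply: connect_trans (uh u) (connect_trans huv _); rewrite se'.
  elim: p u pp => //= v p IHp u /andP[euv /IHp]; apply: connect_trans.
  move: euv; rewrite e'E => /or3P[euv|/andP[/eqP-> /eqP->]|/andP[/eqP-> /eqP->]].
  - have uy : u != y by apply: contraTneq euv => ->.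
    have vy : v != y.
      have: ~~ (v \in pred1 y) by rewrite -(cl u v euv).
      by [].
    by rewrite /h (negPf uy) (negPf vy) connect1.
  - by rewrite /h eqxx eq_sym (negPf yx) connect0.
  by rewrite /h eqxx eq_sym (negPf yx) connect0.
rewrite (adjunction_n_comp h se se' (predC_closed cl) ad).
by apply: eq_n_comp_r => u; rewrite !inE hy.
Qed.

Lemma sum_deg_pendant e e' x y : simple_graph e -> simple_graph e' ->
  (forall v, ~~ e y v) -> y != x ->
  (forall u v, e' u v =
     [|| e u v, (u == x) && (v == y) | (u == y) && (v == x)]) ->
  \sum_u deg e' u = \sum_u deg e u + 2.
Proof.
move=> [se _] _ iso yx e'E.
rewrite (bigD1 x) //= (bigD1 y) //= [in RHS](bigD1 x) //= [in RHS](bigD1 y) //=.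
have dx : deg e' x = (deg e x).+1.
  rewrite /deg (_ : [set v | e' x v] = y |: [set v | e x v]).
    by rewrite cardsU1 inE se (negPf (iso x)).
  apply/setP=> v; rewrite !inE e'E eqxx (eq_sym x) (negPf yx) /= orbF.
  by rewrite orbC.
have dy : deg e' y = (deg e y).+1.
  rewrite /deg (_ : [set v | e' y v] = x |: [set v | e y v]).
    by rewrite cardsU1 inE (negPf (iso x)).
  by apply/setP=> v; rewrite !inE e'E eqxx (negPf yx) /= orbC.
rewrite dx dy.
under eq_bigr => u /andP[ux uy].
  rewrite /deg (_ : [set v | e' u v] = [set v | e u v]); last first.
    by apply/setP=> v; rewrite !inE e'E (negPf ux) (negPf uy) /= orbF.
  over.
rewrite /deg; lia.
Qed.

(** The leaf hypothesis says that [e] is a forest; the conclusion is then edges plus components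
    equals vertices, doubled so that degrees can stand in for edges. *)
Lemma forest_count e : simple_graph e ->
  (forall X, X != set0 -> exists2 y, y \in X & #|[set z in X | e y z]| <= 1) ->
  \sum_u deg e u + 2 * n_comp e T = 2 * #|T|.
Proof.
move=> ge leaf.
(* Induction on the part [X] that keeps its edges. Vertices outside [X] stay as isolated points, so
   the right-hand side never changes; restoring a leaf adds 2 to the degree sum and merges two
   components. *)
suff H N X : #|X| = N -> \sum_u deg (del_rel e (~: X)) u
    + 2 * n_comp (del_rel e (~: X)) T = 2 * #|T|.
  have := H _ [set: T] erefl.
  have E : del_rel e (~: [set: T]) =2 e by move=> u v; rewrite /del_rel /= !inE !andbT.
  rewrite (eq_n_comp (eq_connect E)).
  by under eq_bigr do (rewrite /deg; under eq_finset do rewrite E).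
elim: N X => [|N IHN] X.
  move/eqP; rewrite cards_eq0 => /eqP->.
  have iso u v : ~~ del_rel e (~: set0) u v by rewrite /del_rel /= !inE !andbF.
  rewrite n_comp_isolated ?big1 //; first last.
  - by apply/sym_connect_sym/del_rel_sym; case: ge.
  - move=> u _; apply/eqP; rewrite cards_eq0; apply/eqP/setP=> v.
    by rewrite !inE (negPf (iso u v)).
move=> cX; have [|y yX dy] := leaf X; first by rewrite -card_gt0 cX.
have /IHN : #|X :\ y| = N by rewrite (cardsD1 y X) yX in cX; lia.
set e0 := del_rel e (~: (X :\ y)); set e1 := del_rel e (~: X).
have ge0 : simple_graph e0 by apply: del_rel_simple.
have ge1 : simple_graph e1 by apply: del_rel_simple.
have iso v : ~~ e0 y v by rewrite /e0 /del_rel /= !inE eqxx andbF.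
have [nil|/set0Pn[x]] := eqVneq [set z in X | e y z] set0.
  have nyz z : z \in X -> e y z = false.
    by move=> zX; move/setP/(_ z): nil; rewrite !inE zX.
  have E : e0 =2 e1.
    move=> u v; rewrite /e0 /e1 /del_rel /= !inE !negbK.
    have [->|uy] := eqVneq u y; have [->|vy] := eqVneq v y;
      rewrite ?yX ?andbT ?andbF ?(proj2 ge) //=.
    - by case vX: (v \in X); rewrite ?andbF // nyz.
    - by case uX: (u \in X); rewrite ?andbF // (proj1 ge) nyz.
  rewrite (eq_n_comp (eq_connect E)).
  by under eq_bigr do (rewrite /deg; under eq_finset do rewrite E).
rewrite inE => /andP[xX eyx].
have yx : y != x by apply: contraTneq eyx => ->; rewrite (proj2 ge).
have uq z : z \in X -> e y z -> z = x.
  move=> zX eyz; apply/eqP; move: dy; apply: contraLR => zx.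
  rewrite -ltnNge (cardsD1 x) (cardsD1 z) !inE zX eyz xX eyx zx; lia.
have E u v : e1 u v = [|| e0 u v, (u == x) && (v == y) | (u == y) && (v == x)].
  rewrite /e0 /e1 /del_rel /= !inE !negbK.
  have [->|uy] := eqVneq u y; have [->|vy] := eqVneq v y;
    rewrite ?yX ?andbT ?andbF ?orbF ?(proj2 ge) ?(negPf yx) //=.
  - have [->|vx] := eqVneq v x; first by rewrite eyx.
    by apply/negP=> /andP[eyv vX]; rewrite (uq v) ?eqxx in vx.
  - have [->|ux] := eqVneq u x; first by rewrite (proj1 ge) eyx.
    by apply/negP=> /andP[eyu uX]; rewrite (uq u) ?eqxx // (proj1 ge) in ux.
rewrite (n_comp_pendant (proj1 ge0) (proj1 ge1) iso yx E).
rewrite (sum_deg_pendant ge0 ge1 iso yx E); lia.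
Qed.

End Counting.

(** * Separations of critical edges *)

Lemma exists_set_between (T : finType) (A B : {set T}) n :
  A \subset B -> #|A| <= n <= #|B| ->
  exists C : {set T}, [/\ A \subset C, C \subset B & #|C| = n].
Proof.
elim: n => [|n IHn] AB /andP[An nB].
  by exists A; split=> //; apply/eqP; rewrite -leqn0.
have [An'|nA] := leqP #|A| n; last by exists A; split=> //; lia.
have [|C [AC CB cC]] := IHn AB; first by rewrite An' ltnW.
have /properP[_ [z zB zC]] : C \proper B by rewrite properEcard CB cC.
exists (z |: C); split; last by rewrite cardsU1 zC cC.
  by apply: subset_trans AC _; apply: subsetUr.
by rewrite subUset sub1set zB.
Qed.

Section Connectivity.
Variables (T : finType) (g : rel T) (k : nat).
Hypotheses (sg : simple_graph g) (kg : k_connected g k).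
Implicit Types (A S B X E : {set T}).

Let gsym : symmetric g := proj1 sg.
Let girr : irreflexive g := proj2 sg.

(** A smaller [S] could be padded to exactly [k.-1] vertices avoiding [a] and [o], possible because
    [k < #|T|]; a path from [a] avoiding the padded set never leaves [X], so that set would be a
    forbidden separator. *)
Lemma cut_lower X S a o : a \in X -> o \notin X -> o \notin S ->
  [disjoint X & S] ->
  (forall z w, z \in X -> w \notin X -> g z w -> w \in S) -> k <= #|S|.
Proof.
move=> aX oX oS dXS cl; rewrite leqNgt; apply/negP=> ltS.
case: kg => kT nosep.
have ao : a != o by apply: contraNneq oX => <-.
have aS : a \notin S by rewrite (disjointFr dXS).
have [||S' [SS' S'ao cS']] := @exists_set_between _ S (~: [set a; o]) k.-1.
- by rewrite subsetC; apply/subsetP=> z /set2P[]->; rewrite inE.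
- by have := cardsC [set a; o]; rewrite cards2 ao; lia.
have out z : z \in [set a; o] -> z \notin S'.
  by apply: contraL => /(subsetP S'ao); rewrite inE.
apply: nosep; exists S'; split=> //; exists a, o.
rewrite !out ?inE ?eqxx ?orbT //; split=> //.
apply: contra oX => /connectP[p pp ->].
elim: p a aX {ao aS S'ao out} pp => //= b p IHp a aX /andP[ab]; apply: IHp.
have /andP[/andP[gab _] bS'] := ab.
apply: contraNT bS' => bX; apply: (subsetP SS').
exact: cl aX bX gab.
Qed.

(** Either [x] is adjacent to all other vertices, or its neighbourhood cuts it off from a
    non-neighbour. *)
Lemma leq_deg x : k <= deg g x.
Proof.
case: kg => kT _.
have [/forallP all|oN] := boolP [forall o, (o \in x |: [set y | g x y])].
  apply: leq_trans (_ : #|T|.-1 <= _); first by lia.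
  have -> : #|T| = #|x |: [set y | g x y]|.
    by apply: eq_card => z; rewrite all.
  by rewrite cardsU1 /deg; case: (x \notin _); rewrite ?add0n ?leq_pred.
move: oN => /forallPn[o]; rewrite !inE negb_or => /andP[ox gxo].
apply: (@cut_lower [set x] _ x o); rewrite ?disjoints1 ?inE ?eqxx ?girr //.
by move=> z w /set1P-> _ gxw; rewrite inE.
Qed.

(* The triple (A, S, B) witnesses that the edge xy is critical: deleting S and xy
   separates A from B. Only the bound #|S| < k is required. *)
Definition esep x y A S B :=
  [&& #|S| < k, x \in A, y \in B,
      [forall z, (z \in A) + (z \in S) + (z \in B) == 1]
    & [forall z in A, forall w in B, g z w ==> (z == x) && (w == y)]].

Variant cell_spec A S B z : bool -> bool -> bool -> Prop :=
  | CellA of z \in A : cell_spec A S B z true false false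
  | CellS of z \in S : cell_spec A S B z false true false
  | CellB of z \in B : cell_spec A S B z false false true.

Section Esep.
Variables (x y : T) (A S B : {set T}).
Hypothesis H : esep x y A S B.

Lemma esep_card : #|S| < k. Proof. by case/and5P: H. Qed.
Lemma esep_l : x \in A. Proof. by case/and5P: H. Qed.
Lemma esep_r : y \in B. Proof. by case/and5P: H. Qed.

Lemma esepP z : cell_spec A S B z (z \in A) (z \in S) (z \in B).
Proof.
case/and5P: H => _ _ _ /forallP/(_ z) /eqP + _.
by case zA: (z \in A); case zS: (z \in S); case zB: (z \in B) => //= _; constructor.
Qed.

Lemma esep_cross z w : z \in A -> w \in B -> g z w -> z = x /\ w = y.
Proof.
move=> zA wB gzw; case/and5P: H => _ _ _ _ /forall_inP/(_ _ zA)/forall_inP/(_ _ wB).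
by rewrite gzw => /andP[/eqP-> /eqP->].
Qed.

Lemma esep_cardI X : #|X| = #|X :&: A| + #|X :&: S| + #|X :&: B|.
Proof.
rewrite -(cardsID A X) -(cardsID S (X :\: A)) addnA.
by congr (_ + _ + _); apply: eq_card => z; rewrite !inE;
  case: (esepP z); rewrite ?andbT ?andbF.
Qed.

Lemma esep_sym : esep y x B S A.
Proof.
apply/and5P; split; rewrite ?esep_l ?esep_r ?esep_card //.
  by apply/forallP=> z; case: (esepP z).
apply/forall_inP=> z zB; apply/forall_inP=> w wA; apply/implyP.
by rewrite gsym => gwz; have [-> ->] := esep_cross wA zB gwz; rewrite !eqxx.
Qed.

End Esep.

(** * Corners of two crossing separations *)

Section Corner.
Variables (x y x' y' : T) (A S B A' S' B' E : {set T}).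
Hypotheses (H1 : esep x y A S B) (H2 : esep x' y' A' S' B').

(** Boundary of the corner [A :&: A']. The set [E] is reserved for ends of the edges [xy] and
    [x'y'], the only edges that can leave the corner without meeting the rest of [N]. *)
Local Notation N := ((S :&: A') :|: (S :&: S') :|: (A :&: S') :|: E).

Lemma corner_cardN :
  #|N| <= #|S :&: A'| + #|S :&: S'| + #|A :&: S'| + #|E|.
Proof.
apply: leq_trans (leq_card_setU _ _) _; rewrite leq_add2r.
apply: leq_trans (leq_card_setU _ _) _; rewrite leq_add2r.
exact: leq_card_setU.
Qed.

Lemma corner_step z w : z \in A -> z \in A' -> g z w ->
  [\/ (w \in A) && (w \in A'), w \in N, z = x /\ w = y | z = x' /\ w = y'].
Proof.
move=> zA zA' gzw; rewrite !inE.
case: (esepP H1 w) => [wA|wS|wB]; last by constructor 3; apply: (esep_cross H1).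
  case: (esepP H2 w) => [wA'|wS'|wB']; [by constructor 1|by constructor 2|].
  by constructor 4; apply: (esep_cross H2).
case: (esepP H2 w) => [wA'|wS'|wB']; try by constructor 2.
by constructor 4; apply: (esep_cross H2).
Qed.

(** Once [E] holds an end of each special edge starting in the corner, [N] bounds
    [(A :&: A') :\: E], and [cut_lower] applies. *)
Lemma corner_lower z o : z \in A -> z \in A' -> z \notin E ->
  o \notin E -> (o \in B) || (o \in B') ->
  (x \in A' -> (x \in E) || (y \in E)) ->
  (x' \in A -> (x' \in E) || (y' \in E)) ->
  k <= #|S :&: A'| + #|S :&: S'| + #|A :&: S'| + #|E|.
Proof.
move=> zA zA' zE oE oB xE x'E; apply: leq_trans corner_cardN.
apply: (@cut_lower ((A :&: A') :\: E) _ z o).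
- by rewrite !inE zA zA' zE.
- by move: oB; rewrite !inE; case: (esepP H1 o) (esepP H2 o) => _ []; rewrite ?andbF.
- move: oB; rewrite !inE (negPf oE) orbF.
  by case: (esepP H1 o) (esepP H2 o) => _ [].
- rewrite -setI_eq0; apply/eqP/setP=> w; rewrite !inE.
  by case: (w \in E) (esepP H1 w) (esepP H2 w) => [] [] ? [].
move=> u w; rewrite !inE => /and3P[uE uA uA'] + guw.
rewrite negb_and negbK => wX.
have [/andP[wA wA']|wN|[ux wy]|[ux wy]] := corner_step uA uA' guw.
- by move: wX; rewrite wA wA' orbF => ->; rewrite !orbT.
- by move: wN; rewrite !inE.
- by rewrite ux wy in uE uA' *; move: (xE uA'); rewrite (negPf uE) /= => ->; rewrite !orbT.
by rewrite ux wy in uE uA *; move: (x'E uA); rewrite (negPf uE) /= => ->; rewrite !orbT.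
Qed.

(** A corner with a small boundary is itself a side of a partition for [x'y']: [E] absorbs the edge
    [xy], so only [x'y'] still crosses. *)
Lemma corner_esep : x' \in A -> x' \notin E -> y' \notin E ->
  [disjoint A :&: A' & E] -> (x \in A' -> y \in E) ->
  #|S :&: A'| + #|S :&: S'| + #|A :&: S'| + #|E| < k ->
  exists S1 B1, esep x' y' (A :&: A') S1 B1 /\ S1 \subset A :|: S :|: E.
Proof.
move=> x'A x'E y'E dE yE ltk; exists N, (~: ((A :&: A') :|: N)); split; last first.
  by apply/subsetP=> u; rewrite !inE; case: (esepP H1 u); rewrite ?andbF ?orbF ?orbT.
apply/and5P; split.
- exact: leq_ltn_trans corner_cardN ltk.
- by rewrite inE x'A (esep_l H2).
- rewrite !inE (negPf y'E); have := esep_r H2.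
  by case: (esepP H1 y') (esepP H2 y') => _ [].
- apply/forallP=> w; rewrite !inE; case wE: (w \in E).
    have : w \in A :&: A' = false by rewrite (disjointFl dE).
    by rewrite inE => ->; rewrite !orbT.
  by case: (esepP H1 w) (esepP H2 w) => _ [].
apply/forall_inP=> u; rewrite inE => /andP[uA uA'].
apply/forall_inP=> w wN; apply/implyP => guw.
move: wN; rewrite in_setC in_setU in_setI negb_or => /andP[wX wN].
have [Y|Y|[ux wy]|[-> ->]] := corner_step uA uA' guw.
- by rewrite Y in wX.
- by rewrite Y in wN.
- by case/negP: wN; rewrite wy !inE yE ?orbT // -ux.
by rewrite !eqxx.
Qed.

End Corner.

(** * Separations of two consecutive edges *)

Section Chain.
Variables (x y z : T) (A S B A' S' B' : {set T}).
Hypotheses (H1 : esep x y A S B) (H2 : esep y z A' S' B').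
Hypotheses (xz : x != z) (dy : k < deg g y) (gxy : g x y) (gyz : g y z).

Let yB : y \in B := esep_r H1.
Let yA' : y \in A' := esep_l H2.

Let xB' : x \notin B'.
Proof.
have gyx : g y x by rewrite gsym.
by apply: contra xz => xB'; have [_ ->] := esep_cross H2 yA' xB' gyx.
Qed.

Let zA : z \notin A.
Proof.
have gzy : g z y by rewrite gsym.
by apply: contra xz => zA; have [->] := esep_cross H1 zA yB gzy.
Qed.

(** The corner [B :&: A'] contains [y]. If it is just [y], the more than [k] neighbours of [y] lie
    in its boundary or in [[set x; z]]; otherwise [E := [set y]] absorbs both special edges at cost
    1. *)
Let hub : k <= #|S :&: A'| + #|S :&: S'| + #|B :&: S'| + 1.
Proof.
have [/subsetP sub|/subsetPn[u]] := boolP (B :&: A' \subset [set y]).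
  have dN : deg g y <= #|((S :&: A') :|: (S :&: S') :|: (B :&: S')) :|: [set x; z]|.
    apply: subset_leq_card; apply/subsetP=> w; rewrite inE => gyw.
    have := corner_step set0 (esep_sym H1) H2 yB yA' gyw.
    case=> [wX|wN|[_ ->]|[_ ->]]; last 2 first.
    - by rewrite !inE eqxx !orbT.
    - by rewrite !inE eqxx !orbT.
    - have : w \in B :&: A' by rewrite inE.
      by move=> /sub; rewrite inE => /eqP wy; rewrite wy girr in gyw.
    by move: wN; rewrite !inE orbF => ->.
  have := corner_cardN B S A' S' [set x; z].
  by move: dN dy; rewrite cards2 xz; clear; lia.
rewrite in_setI => /andP[uB uA'] uy.
rewrite -(cards1 y).
by apply: (corner_lower (esep_sym H1) H2 uB uA' uy (o := x));
  rewrite ?inE ?eqxx ?(esep_l H1) //; apply: contraTneq gxy => ->; rewrite girr.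
Qed.

(** No special edge leaves the corner [A :&: B'], so if nonempty it has at least [k] boundary
    vertices. Together with [hub] this gives [#|S| + #|S'|] at least [2k - 1], whereas both sets
    have fewer than [k] elements. *)
Lemma chain_disjoint u : u \in A -> u \notin B'.
Proof.
move=> uA; apply/negP=> uB'.
have := corner_lower H1 (esep_sym H2) (E := set0) (z := u) (o := y) uA uB'.
rewrite !inE yB (negPf xB') (negPf zA) cards0 => /(_ isT isT isT) lo.
have {}lo : k <= #|S :&: B'| + #|S :&: S'| + #|A :&: S'| + 0 by apply: lo.
have := esep_card H1; have := esep_card H2.
rewrite (esep_cardI H2 S) (esep_cardI H1 S') ![S' :&: _]setIC.
have := hub; move: lo; clear; lia.
Qed.

(** By [hub] and [#|S| < k], the part of [B'] in [S] is no larger than [B :&: S']; the vertex [y] in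
    [B :&: A'] makes the inequality strict. *)
Lemma chain_card : #|B'| < #|B|.
Proof.
have A0 : B' :&: A = set0.
  by apply/setP=> u; rewrite !inE; apply/negP=> /andP[uB' /chain_disjoint]; rewrite uB'.
have B1 : 0 < #|B :&: A'| by rewrite card_gt0; apply/set0Pn; exists y; rewrite inE yB yA'.
rewrite (esep_cardI H2 B) (esep_cardI H1 B') A0 cards0.
have := esep_card H1; rewrite (esep_cardI H2 S) ![B' :&: _]setIC.
have := hub; move: B1; clear; lia.
Qed.

End Chain.

End Connectivity.

(** * Separations supplied by minimality *)

Section Critical.
Variables (T : finType) (g : rel T) (k : nat).
Hypotheses (sg : simple_graph g) (mkg : minimally_k_connected g k).
Implicit Types (A S B X E : {set T}).

Let kg : k_connected g k := proj1 mkg.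
Let gsym : symmetric g := proj1 sg.
Let girr : irreflexive g := proj2 sg.
Local Notation esep := (esep g k).

Lemma crossing_esep u v A S B : #|S| < k -> u \in A -> v \in B ->
  [disjoint A & S] -> B = ~: (A :|: S) ->
  (forall z w, z \in A -> w \in B -> ~~ del_edge g u v z w) -> esep u v A S B.
Proof.
move=> cS uA vB dAS BE cr; apply/and5P; split=> //.
  apply/forallP=> z; rewrite BE !inE.
  by case zA: (z \in A); rewrite ?(disjointFr dAS zA) //; case: (z \in S).
apply/forall_inP=> z zA; apply/forall_inP=> w wB; apply/implyP=> gzw.
have := cr z w zA wB; rewrite /del_edge /= gzw negbK => /orP[//|/andP[_ /eqP wu]].
by move: wB; rewrite BE wu !inE uA.
Qed.

Lemma critical_esep u v : 0 < k -> g u v -> exists A S B, esep u v A S B.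
Proof.
move=> k0 guv; set g' := del_edge g u v.
have g'sym : symmetric g'.
  move=> z w; rewrite /g' /del_edge /= gsym; congr (_ && ~~ _).
  by rewrite orbC; congr (_ || _); rewrite andbC.
have kT : k < #|T| by case: kg.
(* A boolean form of separation, so that a finite search yields the separator hidden behind the
   negated [k_connected]. *)
pose P S a b := [&& #|S| == k.-1, a \notin S, b \notin S &
  ~~ connect (del_rel g' S) a b].
have [/existsP[S /existsP[a /existsP[b /and4P[/eqP cS aS bS nab]]]]|none] :=
  boolP [exists S : {set T}, [exists a, [exists b, P S a b]]]; last first.
  case: (proj2 mkg _ _ guv); split=> // -[S [cS [a [b [aS bS nab]]]]].
  case/existsP: none; exists S; apply/existsP; exists a; apply/existsP; exists b.
  by rewrite /P cS eqxx aS bS.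
pose A := [set z | connect (del_rel g' S) a z]; pose B := ~: (A :|: S).
have AS z : z \in A -> z \notin S.
  rewrite inE => /connectP[p pp ->]; elim: p a aS pp {nab A B} => //= c p IHp a aS.
  by case/andP=> /andP[_ cS'] /(IHp _ cS').
have dAS : [disjoint A & S].
  rewrite -setI_eq0; apply/eqP/setP=> z; rewrite !inE.
  by apply/negP=> /andP[zA]; apply/negP/AS; rewrite inE.
have cr z w : z \in A -> w \in B -> ~~ g' z w.
  move=> zA; rewrite inE in_setU negb_or => /andP[wA wS].
  have zS := AS z zA.
  apply: contra wA; rewrite !inE => gzw.
  rewrite inE in zA; apply: connect_trans zA (connect1 _).
  by rewrite /del_rel /= wS zS !andbT.
(* Without such an edge the [k.-1] vertices of [S] would bound [A] in [g] itself. As it is absent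
   from [g'], it must be [uv], in one of its two directions. *)
have [z zA [w wB gzw]] : exists2 z, z \in A & exists2 w, w \in B & g z w.
  have [/existsP[z /andP[zA /existsP[w /andP[wB gzw]]]]|no] :=
    boolP [exists z, (z \in A) && [exists w, (w \in B) && g z w]].
    by exists z => //; exists w.
  have aA : a \in A by rewrite inE connect0.
  have bA : b \notin A by rewrite inE.
  have := cut_lower kg aA bA bS dAS; rewrite cS.
  have cl z w : z \in A -> w \notin A -> g z w -> w \in S.
    move=> zA wA gzw; apply: contraNT no => wS; apply/existsP; exists z.
    by rewrite zA; apply/existsP; exists w; rewrite in_setC in_setU negb_or wA wS.
  by move=> /(_ cl); lia.
have cS' : #|S| < k by rewrite cS; lia.
have := cr z w zA wB; rewrite /g' /del_edge /= gzw negbK.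
case/orP=> /andP[/eqP zu /eqP wv]; rewrite zu wv in zA wB.
  by exists A, S, B; apply: crossing_esep.
exists B, S, A; apply: esep_sym => //; apply: crossing_esep => // z' w' zA' wB'.
have := cr z' w' zA' wB'; apply: contra; rewrite /g' /del_edge /=.
by rewrite orbC.
Qed.

(** The starting partition for [path_avoid]: [v] alone, cut off by its other [k - 1] neighbours. *)
Lemma star_esep v w : 0 < k -> deg g v = k -> g v w ->
  esep v w [set v] ([set y | g v y] :\ w) (~: ([set v] :|: ([set y | g v y] :\ w))).
Proof.
move=> k0 dv gvw.
have vw : w != v by apply: contraTneq gvw => ->; rewrite girr.
apply: crossing_esep => //.
- have := dv; rewrite /deg (cardsD1 w) inE gvw /=; lia.
- by rewrite inE.
- by rewrite !inE eqxx /= orbF vw.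
- by rewrite disjoints1 !inE girr andbF.
move=> z u /set1P->; rewrite !inE negb_or negb_and negbK /del_edge /=.
move=> /andP[uv /orP[/eqP->|/negPf->//]].
by rewrite !eqxx andbF.
Qed.

(* A path in F between two neighbours w1, w2 of v, together with v, is a cycle
   on which v is the only vertex of degree k. Along it the sides A increase in
   the sense of [chain_disjoint], so v, which starts in A, never leaves A unless
   it falls into some S; yet the last vertex w2 lies in B and is adjacent to v. *)
Lemma path_avoid v w2 (e : rel T) x u p A S B :
  (forall a b, e a b -> [/\ g a b, k < deg g b &
     exists A S B, esep a b A S B /\ v \notin S]) ->
  k < deg g u -> g x u -> g v w2 -> esep x u A S B -> v \in A ->
  (x != v) || (p != [::]) -> v \notin p ->
  path e u p -> uniq (x :: u :: p) -> last u p = w2 -> False.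
Proof.
move=> eP + + gv; elim: p x u A S B => [|u' p IHp] x u A S B du gxu H vA.
  (* The edge from [v] in [A] to [w2 = u] in [B] can only be [xu], so [v = x]; the side condition
     excludes this once the path is exhausted. *)
  rewrite orbF /= => xv _ _ _ uw; rewrite -uw in gv.
  by have [vx _] := esep_cross H vA (esep_r H) gv; rewrite vx eqxx in xv.
move=> _; rewrite inE negb_or => /andP[vu' vp] /= /andP[euu' pp].
case/andP; rewrite !inE !negb_or => /and3P[xu xu' xp] /andP[/andP[uu' up] /andP[u'p uqp]].
have [guu' du' [A' [S' [B' [H' vS']]]]] := eP _ _ euu'.
have vB' := chain_disjoint sg kg H H' xu' du gxu guu' vA.
have vA' : v \in A' by move: vS' vB'; case: (esepP H' v).
apply: (IHp u u' A' S' B') => //.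
- have [uv|//] := eqVneq u v.
  by move: vA; rewrite -uv; have := esep_r H; case: (esepP H u).
- by rewrite /= inE negb_or uu' up u'p uqp.
Qed.

End Critical.

(** * Uncrossing with a minimal separation *)

Section Minimal.
Variables (T : finType) (g : rel T) (k : nat).
Hypotheses (sg : simple_graph g) (mkg : minimally_k_connected g k) (k0 : 0 < k).
Implicit Types (A S B X E : {set T}).

Let kg : k_connected g k := proj1 mkg.
Let gsym : symmetric g := proj1 sg.
Local Notation esep := (esep g k).

(** Adjacency in F, since all degrees are at least [k]. *)
Definition high_edge u w := [&& g u w, k < deg g u & k < deg g w].

Lemma high_edge_sym : symmetric high_edge.
Proof. by move=> u w; rewrite /high_edge gsym [(k < _) && _]andbC. Qed.

Lemma exists_min_esep X u w : u \in X -> w \in X -> high_edge u w ->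
  exists x y A S B, [/\ esep x y A S B, high_edge x y, x \in X, y \in X &
    forall x' y' A' S' B', x' \in X -> y' \in X -> high_edge x' y' ->
      esep x' y' A' S' B' -> #|B| <= #|B'|].
Proof.
move=> uX wX euw; have [A0 [S0 [B0 H0]]] := critical_esep sg mkg k0 (proj1 (andP euw)).
pose P (i : T * T * ({set T} * {set T} * {set T})) :=
  [&& i.1.1 \in X, i.1.2 \in X, high_edge i.1.1 i.1.2 &
     esep i.1.1 i.1.2 i.2.1.1 i.2.1.2 i.2.2].
have P0 : P (u, w, (A0, S0, B0)) by rewrite /P uX wX euw H0.
case: (arg_minnP (fun i : T * T * ({set T} * {set T} * {set T}) => #|i.2.2|) P0).
case=> -[x y] [[A S] B] /and4P[xX yX exy H] mn.
exists x, y, A, S, B; split=> // x' y' A' S' B' xX' yX' exy' H'.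
by apply: (mn (x', y', (A', S', B'))); rewrite /P xX' yX' exy' H'.
Qed.

(** A second neighbour [z] would give, by [chain_card], a partition for [yz] with a smaller last
    side. *)
Lemma min_esep_leaf X x y z A S B : esep x y A S B -> high_edge x y -> z \in X ->
  y \in X -> (forall x' y' A' S' B', x' \in X -> y' \in X -> high_edge x' y' ->
    esep x' y' A' S' B' -> #|B| <= #|B'|) -> high_edge y z -> z = x.
Proof.
move=> H /and3P[gxy _ dy] zX yX mn eyz; have /and3P[gyz _ _] := eyz.
apply/eqP; apply: contraT; rewrite eq_sym => xz.
have [A' [S' [B' H']]] := critical_esep sg mkg k0 gyz.
have := chain_card sg kg H H' xz dy gxy gyz.
by rewrite ltnNge (mn y z A' S' B').
Qed.

Lemma exists_leaf X : X != set0 ->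
  exists2 y, y \in X & #|[set z in X | high_edge y z]| <= 1.
Proof.
case/set0Pn=> u uX; have [du|] := leqP #|[set z in X | high_edge u z]| 1.
  by exists u.
move/ltnW; rewrite card_gt0 => /set0Pn[w]; rewrite inE => /andP[wX euw].
have [x [y [A [S [B [H exy xX yX mn]]]]]] := exists_min_esep uX wX euw.
exists y => //; rewrite -(cards1 x); apply: subset_leq_card; apply/subsetP=> z.
by rewrite !inE => /andP[zX /(min_esep_leaf H exy zX yX mn)->].
Qed.

Section Crossing.
Variables (x y : T) (A S B : {set T}).
Hypotheses (H : esep x y A S B) (exy : high_edge x y).
Hypothesis Bmin : forall x' y' A' S' B', high_edge x' y' ->
    esep x' y' A' S' B' -> #|B| <= #|B'|.

(** Reversing an edge swaps the sides, so minimality bounds both of them. *)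
Let Bmin' x' y' A' S' B' : high_edge x' y' -> esep x' y' A' S' B' -> #|B| <= #|A'|.
Proof. by rewrite high_edge_sym => e /(esep_sym sg); apply: Bmin. Qed.

Let xA := esep_l H.
Let yB := esep_r H.
Let Hs := esep_sym sg H.

(* Each nonempty corner of the two partitions has at least k boundary vertices;
   the alternatives follow from |S|, |S'| < k and the minimality of |B|. *)
Lemma crossing_half v a b A' S' B' : esep a b A' S' B' -> high_edge a b ->
  v \in B -> v != y -> v \in S' -> x \notin B' -> y \notin B' ->
  (exists A S B, esep a b A S B /\ v \notin S) \/ (B \subset S' /\ 2 * #|B| < k).
Proof.
move=> H' eab vB vy vS' xB' yB'.
have aA' := esep_l H'; have bB' := esep_r H'; have H's := esep_sym sg H'.
have ltB X : v \notin X -> #|B :&: X| < #|B|.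
  move=> vX; apply: proper_card; rewrite properE subsetIl /=.
  by apply/subsetPn; exists v; rewrite // inE (negPf vX) andbF.
have [vA' vB'] : v \notin A' /\ v \notin B' by move: vS'; case: (esepP H' v).
have vA : v \notin A by move: vB; case: (esepP H v).
have vS : v \notin S by move: vB; case: (esepP H v).
have yA : y \notin A by move: yB; case: (esepP H y).
have xB : x \notin B by move: xA; case: (esepP H x).
have xb : x != b by apply: contraNneq xB' => ->.
have yb : y != b by apply: contraNneq yB' => ->.
have bA' : b \notin A' by move: bB'; case: (esepP H' b).
have aB' : a \notin B' by move: aA'; case: (esepP H' a).
(* An end of [ab] is put into [E] only when [ab] may leave the corner, so the cost is exactly the
   boolean [c]. *)
pose opt (c : bool) (z : T) := if c then [set z] else set0.
have optN c z u : u != z -> u \notin opt c z.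
  by rewrite /opt => uz; case: c; rewrite inE.
have copt c z : #|opt c z| = c by rewrite /opt; case: c; rewrite ?cards1 ?cards0.
have optT (c : bool) z : c -> z \in opt c z by rewrite /opt => ->; rewrite inE.
pose p := #|S :&: A'|; pose q := #|S :&: S'|; pose r := #|S :&: B'|.
pose s := #|A :&: S'|; pose t := #|B :&: S'|.
(* If [y] is in this corner and the bound fails, the corner becomes a side for [yx] that lies in [B]
   and misses [v], against minimality. *)
have BA z : z \in B -> z \in A' -> k <= p + q + t + (a \in B).
  move=> zB zA'; have [yA'|yA'] := boolP (y \in A').
    rewrite leqNgt; apply/negP=> lt.
    have [|||S1 [B1 [/(Bmin' _)]]] :=
        corner_esep (E := opt (a \in B) b) H' Hs yA' (optN _ _ _ yb) (optN _ _ _ xb).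
    - rewrite -setI_eq0; apply/eqP/setP=> u; rewrite !inE; apply/negP.
      case/andP=> /andP[uA' _]; apply/negP/optN.
      by apply: contraNneq bA' => <-.
    - exact: optT.
    - by rewrite copt (setIC S' B) (setIC S' S) (setIC A' S); move: lt; rewrite /p /q /t; clear; lia.
    by rewrite high_edge_sym setIC => /(_ exy); rewrite leqNgt ltB.
  rewrite -(copt (a \in B) b).
  apply: (corner_lower kg Hs H' zB zA' (o := x)); rewrite ?optN ?xA //.
  - by apply: contraNneq bA' => <-.
  - by rewrite (negPf yA').
  by move=> aB; rewrite optT ?orbT.
have AB z : z \in A -> z \in B' -> k <= r + q + s + (b \in A).
  move=> zA zB'; rewrite -(copt (b \in A) a).
  apply: (corner_lower kg H H's zA zB' (o := v)); rewrite ?optN ?vB //.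
  - by apply: contraNneq aB' => <-.
  - by apply: contraNneq vA' => ->.
  - by rewrite (negPf xB').
  by move=> bA; rewrite optT ?orbT.
have BB z : z \in B -> z \in B' -> k <= r + q + t.
  move=> zB zB'; have [bB|bB] := boolP (b \in B); last first.
    rewrite -[X in _ <= X]addn0 -(cards0 T).
    by apply: (corner_lower kg Hs H's zB zB' (o := x));
      rewrite ?inE ?xA ?(negPf yB') ?(negPf bB).
  rewrite leqNgt; apply/negP=> lt.
  have [|||||S1 [B1 [/(Bmin' _)]]] := corner_esep (E := set0) Hs H's bB.
  - by rewrite inE.
  - by rewrite inE.
  - by rewrite -setI_eq0 setI0.
  - by rewrite (negPf yB').
  - by rewrite cards0 addn0.
  by rewrite high_edge_sym => /(_ eab); rewrite leqNgt ltB.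
(* Here a small boundary is welcome when [a] is in [A]: the new separator lies in [A], [S] and
   [[set y]], hence avoids [v]. *)
have AA z : z \in A -> z \in A' -> (exists A S B, esep a b A S B /\ v \notin S) \/
    k <= p + q + s + 1.
  move=> zA zA'; have [lt|] := ltnP (p + q + s + 1) k; [left|by right].
  have ny u : u \in A -> u \notin [set y].
    by rewrite inE => uA; apply: contraNneq yA => <-.
  have [aA|aA] := boolP (a \in A).
    have [|||||S1 [B1 [H1 sub]]] := corner_esep (E := [set y]) H H' aA.
    - exact: ny.
    - by rewrite inE eq_sym.
    - by rewrite disjoint_sym disjoints1 inE (negPf yA).
    - by rewrite inE eqxx.
    - by rewrite cards1.
    exists (A :&: A'), S1, B1; split=> //; apply/negP=> /(subsetP sub).
    by rewrite !inE (negPf vA) (negPf vS) (negPf vy).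
  have := corner_lower kg H H' zA zA' (ny _ zA) (o := v).
  rewrite !inE eqxx vy vB (negPf aA) orbT cards1 => /(_ isT isT) lo.
  by move: lt; rewrite ltnNge lo.
have abAB : (a \in B) + (b \in A) <= 1.
  case aB: (a \in B); case bA: (b \in A) => //.
  have gba : g b a by rewrite gsym; case/and3P: eab.
  by have [bx _] := esep_cross H bA aB gba; rewrite bx eqxx in xb.
have cS := esep_card H; have cS' := esep_card H'.
have cB := Bmin eab H'; have cA := Bmin' exy H; have cA' := Bmin' eab H'.
have cB2 := esep_cardI H' B.
rewrite (esep_cardI H' S) in cS; rewrite (esep_cardI H S') !(setIC S') in cS'.
rewrite (esep_cardI H' A) in cA; rewrite (esep_cardI H A') !(setIC A') in cA'.
rewrite (esep_cardI H B') !(setIC B') in cB.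
have pos X Y : 0 < #|X :&: Y| -> exists z, z \in X /\ z \in Y.
  by rewrite card_gt0 => /set0Pn[z /setIP[]]; exists z.
have {BA} BA : 0 < #|B :&: A'| -> k <= p + q + t + (a \in B).
  by case/pos=> z [zB]; apply: BA zB.
have {AB} AB : 0 < #|A :&: B'| -> k <= r + q + s + (b \in A).
  by case/pos=> z [zB]; apply: AB zB.
have {BB} BB : 0 < #|B :&: B'| -> k <= r + q + t.
  by case/pos=> z [zB]; apply: BB zB.
have {pos AA} [left_|AA] : (exists A S B, esep a b A S B /\ v \notin S) \/
    (0 < #|A :&: A'| -> k <= p + q + s + 1).
  case: (posnP #|A :&: A'|) => [_|/pos[z [zA /(AA z zA)]]]; first by right.
  by case; [left | right].
  by left.
right.
(* Opposite corners cannot both be nonempty: their boundaries sum to [#|S| + #|S'|], at most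
   [2k - 2], but would need [2k - 1]. Minimality then empties both corners inside [B], so
   [#|B| = t]; finally [p] and [r] are at least [t], whence [2t] is at most [#|S|]. *)
suff [eB le] : #|B| = t /\ 2 * #|B| < k.
  split=> //; apply/setIidPl/eqP; rewrite eqEcard subsetIl /=.
  by rewrite -/t -eB.
rewrite -/p -/q -/r -/s -/t in cS cS' cA cA' cB cB2 BA AB BB AA.
move: cS cS' cA cA' cB cB2 BA AB BB AA abAB.
rewrite -/p -/q -/r -/s -/t.
move: (p) (q) (r) (s) (t) (a \in B : nat) (b \in A : nat) #|B| #|B :&: A'| #|B :&: B'|
  #|A :&: A'| #|A :&: B'|.
clear; lia.
Qed.

(** Up to swapping [A'] and [B'] this is [crossing_half], unless [x] and [y] lie on opposite sides;
    then [ab] is the edge [xy], and [S] already avoids [v]. *)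
Lemma crossing v a b A' S' B' : esep a b A' S' B' -> high_edge a b ->
  v \in B -> v != y -> v \in S' ->
  (exists A S B, esep a b A S B /\ v \notin S) \/ (B \subset S' /\ 2 * #|B| < k).
Proof.
move=> H' eab vB vy vS'.
have vS : v \notin S by move: vB; case: (esepP H v).
have /and3P[gxy _ _] := exy.
have gyx : g y x by rewrite gsym.
have half2 : x \notin A' -> y \notin A' ->
    (exists A S B, esep a b A S B /\ v \notin S) \/ (B \subset S' /\ 2 * #|B| < k).
  have eba : high_edge b a by rewrite high_edge_sym.
  move=> xA' yA'; have [] := crossing_half (esep_sym sg H') eba vB vy vS' xA' yA'; last by right.
  case=> A1 [S1 [B1 [H1 vS1]]]; left; exists B1, S1, A1; split=> //.
  exact: esep_sym.
case: (boolP (x \in B')) (boolP (y \in B')) => [xB'|xB'] [yB'|yB'].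
- by apply: half2; [move: xB'; case: (esepP H' x) | move: yB'; case: (esepP H' y)].
- have [yA'|yA'] := boolP (y \in A').
    have [ya xb] := esep_cross H' yA' xB' gyx; left; exists B, S, A.
    by rewrite -ya -xb.
  by apply: half2 yA'; move: xB'; case: (esepP H' x).
- have [xA'|xA'] := boolP (x \in A').
    have [xa yb] := esep_cross H' xA' yB' gxy; left; exists A, S, B.
    by rewrite -xa -yb.
  by apply: half2; move: yB'; case: (esepP H' y).
exact: crossing_half H' eab vB vy vS' xB' yB'.
Qed.

End Crossing.
End Minimal.

(** * Vertices of degree k *)

Section DegreeSums.
Variables (T : finType) (g : rel T).
Hypothesis sg : simple_graph g.
Implicit Types (D : {set T}).

Lemma deg_sum e x : @deg T e x = \sum_y (e x y : nat).
Proof. by rewrite /deg -sum1dep_card big_mkcond; apply: eq_bigr => y _; case: (e x y). Qed.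

Lemma sum_deg_del_rel D :
  \sum_x deg (del_rel g D) x = \sum_(x | x \notin D) \sum_(y | y \notin D) (g x y : nat).
Proof.
rewrite [RHS]big_mkcond; apply: eq_bigr => x _; rewrite deg_sum.
case: ifP => xD; last first.
  by rewrite big1 // => y _; rewrite /del_rel /= xD andbF.
rewrite [RHS]big_mkcond; apply: eq_bigr => y _; rewrite /del_rel /= xD andbT.
by case: (y \in D); rewrite ?andbF ?andbT.
Qed.

(** Both sides count the adjacency matrix in blocks: twice the block inside [D], both mixed blocks,
    and the block outside [D]. *)
Lemma sum_deg_split D :
  \sum_x deg g x + \sum_x deg (del_rel g (~: D)) x =
  2 * (\sum_(x in D) deg g x) + \sum_x deg (del_rel g D) x.
Proof.
pose s (P Q : pred T) := \sum_(x | P x) \sum_(y | Q y) (g x y : nat).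
have sC P Q : s P Q = s Q P.
  rewrite /s exchange_big; apply: eq_bigr => x _; apply: eq_bigr => y _.
  by rewrite (proj1 sg).
have sP P : \sum_(x | P x) deg g x = s P (mem D) + s P (predC (mem D)).
  rewrite -big_split; apply: eq_bigr => x _.
  by rewrite deg_sum (bigID (mem D)).
have -> : \sum_x deg g x = \sum_(x in D) deg g x + \sum_(x | x \notin D) deg g x.
  by rewrite (bigID (mem D)).
rewrite !sum_deg_del_rel.
have -> : \sum_(x | x \notin ~: D) \sum_(y | y \notin ~: D) (g x y : nat) = s (mem D) (mem D).
  by rewrite /s; apply: eq_big => [x|x _]; [|apply: eq_bigl => y]; rewrite inE negbK.
have e1 := sP (mem D); have e2 := sP (predC (mem D)); have e3 := sC (mem D) (predC (mem D)).
rewrite /= in e1 e2 *; rewrite e1 e2 /s /= in e3 *.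
move: e3; rewrite /s /=; clear; lia.
Qed.

End DegreeSums.

(** * The lower bound on components plus edges, and the edge count *)

Section Main.
Variables (T : finType) (g : rel T) (k : nat).
Hypotheses (sg : simple_graph g) (mkg : minimally_k_connected g k) (k0 : 0 < k).
Implicit Types (A S B X E : {set T}).

Let kg : k_connected g k := proj1 mkg.
Let gsym : symmetric g := proj1 sg.
Let girr : irreflexive g := proj2 sg.
Local Notation esep := (esep g k).
Local Notation D := (Vdeg g k).
Local Notation F := (del_rel g (Vdeg g k)).
Local Notation nb v := [set y | g v y].

Lemma notin_Vdeg x : (x \notin D) = (k < deg g x).
Proof. by rewrite inE ltn_neqAle (leq_deg sg kg) andbT eq_sym. Qed.

Lemma high_edgeE a b : high_edge g k a b = F a b.
Proof. by rewrite /high_edge /del_rel /= !notin_Vdeg andbA. Qed.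

Let F_sym : connect_sym F.
Proof. by apply/sym_connect_sym/del_rel_sym. Qed.

Let nbD_Edeg v w : v \in D -> w \in nb v :&: D -> [set v; w] \in Edeg g k.
Proof.
move=> vD; rewrite !in_setI inE => /andP[gvw wD].
rewrite inE; apply/andP; split.
  by apply/imset2P; exists v w; rewrite ?inE.
by apply/subsetP=> z /set2P[]->.
Qed.

Let pair_inj v : {in nb v &, injective (fun w => [set v; w])}.
Proof.
move=> w1 w2; rewrite !inE => g1 g2 E.
have: w1 \in [set v; w2] by rewrite -E !inE eqxx orbT.
by case/set2P=> // w1v; rewrite w1v girr in g1.
Qed.

Let card_pairs v : #|(fun w => [set v; w]) @: (nb v :&: D)| = #|nb v :&: D|.
Proof.
apply: card_in_imset => w1 w2 /setIP[w1v _] /setIP[w2v _]; exact: pair_inj.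
Qed.

(** The [k] neighbours [w] of [v] are counted injectively: those in [D] by the edge [vw], the others
    by their component of F. *)
Lemma bound_of_good_vertex v : v \in D ->
  (forall w1 w2, g v w1 -> g v w2 -> w1 \notin D -> w2 \notin D ->
     connect F w1 w2 -> w1 = w2) ->
  k <= cF g k + #|Edeg g k|.
Proof.
move=> vD good.
have dv : #|nb v| = k by apply/eqP; rewrite inE in vD.
rewrite -{1}dv -(cardsID D) addnC leq_add //; last first.
  rewrite -card_pairs; apply: subset_leq_card.
  by apply/subsetP=> _ /imsetP[w wv ->]; apply: nbD_Edeg.
have cl : closed F (~: D).
  apply: (intro_closed F_sym) => a b; rewrite /del_rel /= => /andP[_ bD] _.
  by rewrite inE.
rewrite -(card_in_imset (f := fingraph.root F)).
  apply: subset_leq_card; apply/subsetP=> _ /imsetP[w /setDP[_ wD] ->].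
  rewrite inE /= roots_root //= -(closed_connect cl (connect_root F w)).
  by rewrite inE.
move=> w1 w2; rewrite !inE => /andP[w1D g1] /andP[w2D g2] /(fingraph.rootP F_sym).
by apply: good; rewrite // inE.
Qed.

(** Edges at [v] and edges at [v'] can share only the edge [vv']. *)
Lemma card_Edeg_two v v' m : v \in D -> v' \in D -> v != v' ->
  m <= #|nb v :&: D| -> m <= #|nb v' :&: D| -> 2 * m <= #|Edeg g k| + 1.
Proof.
move=> vD v'D vv' mv mv'.
pose I u := (fun w => [set u; w]) @: (nb u :&: D).
have sub u : u \in D -> I u \subset Edeg g k.
  by move=> uD; apply/subsetP=> _ /imsetP[w wv ->]; apply: nbD_Edeg.
have sUI : #|I v :|: I v'| <= #|Edeg g k|.
  by apply: subset_leq_card; rewrite subUset !sub.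
have sII : #|I v :&: I v'| <= 1.
  rewrite -(cards1 [set v; v']); apply: subset_leq_card.
  apply/subsetP=> W /setIP[/imsetP[w _ ->] /imsetP[w' _ E]]; rewrite inE; apply/eqP.
  have: v' \in [set v; w] by rewrite E !inE eqxx.
  by case/set2P=> [vE|->] //; rewrite vE eqxx in vv'.
have := cardsUI (I v) (I v'); rewrite !card_pairs.
move: sUI sII mv mv'; clear; lia.
Qed.

Lemma connect_avoid v w1 w2 (e : rel T) :
  (forall a b, e a b -> F a b /\ exists A S B, esep a b A S B /\ v \notin S) ->
  v \in D -> w1 \notin D -> w2 \notin D -> g v w1 -> g v w2 -> connect e w1 w2 -> w1 = w2.
Proof.
move=> eP vD w1D w2D g1 g2 /connectP[p0 /shortenP[p pp up _] {p0} E].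
apply/eqP; apply: contraT => w12.
have pF z : z \in p -> z \notin D.
  elim: p w1 pp {up E g1 w1D w12} => //= c p IHp b /andP[/eP[+ _] /IHp ih].
  by rewrite /del_rel /= inE => /andP[_ cD] /orP[/eqP->|/ih].
have dv : deg g v = k by apply/eqP; rewrite inE in vD.
(* The walk starts with the edge from [v] to [w1]; since here [x] is [v], the rest [p] must be
   nonempty, which [w1 != w2] ensures. *)
case: (@path_avoid T g k sg mkg v w2 e v w1 p _ _ _ _ _ g1 g2 (star_esep sg k0 dv g1)).
- move=> a b /eP[Fab ex]; have := Fab; rewrite -high_edgeE => /and3P[gab _ db].
  by split.
- by rewrite -notin_Vdeg.
- by rewrite inE.
- by rewrite eqxx; apply: contraNneq w12 => pn; rewrite E pn.
- by apply: contraL vD => /pF.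
- by [].
- rewrite cons_uniq up andbT inE negb_or; apply/andP; split.
    by apply: contraNneq w1D => <-.
  by apply: contraL vD => /pF.
by [].
Qed.

Lemma bound_cF_Edeg : k <= cF g k + #|Edeg g k|.
Proof.
have [/existsP[x0 /existsP[y0 e0]]|none] := boolP [exists a, [exists b, F a b]]; last first.
  have noF a b : ~~ F a b.
    by apply: contra none => Fab; apply/existsP; exists a; apply/existsP; exists b.
  have [v vD] : exists v, v \in D.
    have /card_gt0P[u _] : 0 < #|T| by case: kg => kT _; lia.
    have [uD|uD] := boolP (u \in D); first by exists u.
    have /card_gt0P[w] : 0 < deg g u by rewrite (leq_trans k0) ?(leq_deg sg kg).
    rewrite inE => guw; exists w; apply: contraNT (noF u w) => wD.
    by rewrite /del_rel /= guw uD wD.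
  apply: (bound_of_good_vertex vD) => w1 w2 _ _ _ _ /connectP[[|z p] /=]; first by [].
  by rewrite (negPf (noF _ _)).
rewrite -high_edgeE in e0.
have [x [y [A [S [B [H exy _ _ mn]]]]]] :=
  exists_min_esep sg mkg k0 (in_setT x0) (in_setT y0) e0.
have Bmin x' y' A' S' B' : high_edge g k x' y' -> esep x' y' A' S' B' -> #|B| <= #|B'|.
  by apply: mn; rewrite inE.
have leaf z : F y z -> z = x.
  by rewrite -high_edgeE; apply: (min_esep_leaf sg mkg k0 H exy (in_setT z) (in_setT y) mn).
have /and3P[_ _ dy] := exy.
have yB := esep_r H; have xA := esep_l H.
have yD : y \notin D by rewrite notin_Vdeg.
have cross u w : u \in B -> u != y -> g u w -> w \notin A.
  move=> uB uy guw; apply: contra uy => wA.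
  by have [->] := esep_cross (esep_sym sg H) uB wA guw.
(* As [y] is a leaf of F, its neighbours other than [x], at least [k] of them, lie in [D] and in [B]
   or [S], while [#|S| < k]. *)
have hphi : #|S :\: D| < #|B :&: D|.
  have sub : nb y \subset x |: ((B :&: D) :|: (S :&: D)).
    apply/subsetP=> w; rewrite inE => gyw; rewrite in_setU1.
    have [//|wx] := eqVneq w x; rewrite /= !in_setU !in_setI.
    have wD : w \in D.
      by apply: contraNT wx => wD; rewrite (leaf w) // /del_rel /= gyw yD wD.
    rewrite wD !andbT; case: (esepP H w) => // wA.
    by have [_ wx'] := esep_cross (esep_sym sg H) yB wA gyw; rewrite wx' eqxx in wx.
  have c1 := subset_leq_card sub; rewrite cardsU1 in c1.
  have c0 : k < #|nb y| := dy.
  have [c2 _] := leq_card_setU (B :&: D) (S :&: D).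
  have c3 := cardsID D S; have c4 := esep_card H.
  move: c0 c1 c2 c3 c4; clear; case: (_ \notin _); lia.
have [v /setIP[vB vD]] : exists v, v \in B :&: D.
  by apply/card_gt0P; move: hphi; clear; lia.
have vy : v != y by apply: contraNneq yD => <-.
pose e a b := F a b &&
  [exists A', exists S', exists B', esep a b A' S' B' && (v \notin S')].
have eP a b : e a b -> F a b /\ exists A S B, esep a b A S B /\ v \notin S.
  case/andP=> Fab /existsP[A' /existsP[S' /existsP[B' /andP[H' vS']]]].
  by split=> //; exists A', S', B'.
have eI a b A' S' B' : F a b -> esep a b A' S' B' -> v \notin S' -> e a b.
  move=> Fab H' vS'; rewrite /e Fab; apply/existsP; exists A'.
  by apply/existsP; exists S'; apply/existsP; exists B'; rewrite H'.
have small a b : F a b -> ~~ e a b -> [/\ a \notin B, b \notin B & 2 * #|B| < k].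
  move=> Fab nab; have := Fab; rewrite -high_edgeE => eab.
  have /and3P[gab _ _] := eab.
  have [A' [S' [B' H']]] := critical_esep sg mkg k0 gab.
  have vS' : v \in S' by apply: contraNT nab; apply: eI H'.
  have [[A1 [S1 [B1 [H1 vS1]]]]|[BS' c]] := crossing sg mkg H exy Bmin H' eab vB vy vS'.
    by rewrite (eI _ _ _ _ _ Fab H1 vS1) in nab.
  split=> //; apply/negP=> /(subsetP BS').
    by have := esep_l H'; case: (esepP H' a).
  by have := esep_r H'; case: (esepP H' b).
have good : (forall w1 w2, g v w1 -> g v w2 -> w1 \notin D -> w2 \notin D ->
    w1 != w2 -> connect F w1 w2 -> connect e w1 w2 \/ connect e w2 w1) ->
    k <= cF g k + #|Edeg g k|.
  move=> Fe; apply: (bound_of_good_vertex vD) => w1 w2 g1 g2 w1D w2D cF12.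
  have [//|w12] := eqVneq w1 w2.
  by case: (Fe _ _ g1 g2 w1D w2D w12 cF12) => /(connect_avoid eP vD) ->.
have [/forallP all|] := boolP [forall a, [forall b, F a b ==> e a b]].
  apply: good => w1 w2 _ _ _ _ _ c; left; apply: connect_sub c => a b Fab.
  by apply: connect1; have /forallP/(_ b) := all a; rewrite Fab.
case/forallPn=> a /forallPn[b]; rewrite negb_imply => /andP[Fab nab].
have [_ _ cB] := small a b Fab nab.
(* With two vertices of [D] in [B]: by [hphi] each has at most [#|B| - 1] neighbours outside [D],
   and [2 * #|B| < k] makes their edges in [Edeg g k] exceed [k]. *)
have [h2|h1] := ltnP 1 #|B :&: D|.
  have [v'] : exists v', v' \in (B :&: D) :\ v.
    by apply/card_gt0P; move: h2; rewrite (cardsD1 v (B :&: D)) in_setI vB vD; clear; lia.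
  rewrite in_setD1 => /andP[v'v /setIP[v'B v'D]].
  have many u : u \in B -> u \in D -> k - #|B| + 1 <= #|nb u :&: D|.
    move=> uB uD; have uy : u != y by apply: contraNneq yD => <-.
    have sub : nb u :\: D \subset (B :\: D) :|: (S :\: D).
      apply/subsetP=> w; rewrite !inE => /andP[-> guw] /=.
      by move: (cross u w uB uy guw); case: (esepP H w).
    have c1 := leq_trans (subset_leq_card sub) (leq_card_setU _ _).
    have c2 := cardsID D (nb u); have c3 := cardsID D B.
    have du : #|nb u| = k by apply/eqP; rewrite inE in uD.
    move: c1 c2 c3 du hphi cB; clear; lia.
  have vv' : v != v' by rewrite eq_sym.
  have := card_Edeg_two vD v'D vv' (many _ vB vD) (many _ v'B v'D).
  move: cB; clear; lia.
have SD : S \subset D.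
  rewrite -setD_eq0 -cards_eq0; move: hphi h1; clear; lia.
(* The path stays in [B] without [y]: [S] lies in [D], hence is avoided by F, and the only
   F-neighbour of [y] is [x], outside [B]. By [small], edges of F meeting [B] belong to [e]. *)
have half w1 w2 : g v w1 -> w1 \notin D -> w1 != y -> connect F w1 w2 -> connect e w1 w2.
  move=> g1 w1D w1y c12.
  pose P := [pred u | [&& connect e w1 u, u \in B & u != y]].
  have cl : closed F P.
    apply: (intro_closed F_sym) => u u' Fuu' /and3P[c uB uy].
    have := Fuu'; rewrite /del_rel /= => /andP[/andP[guu' uD] u'D].
    have u'B : u' \in B.
      move: (cross u u' uB uy guu') (contraNN (subsetP SD u') u'D).
      by case: (esepP H u').
    have u'y : u' != y.
      apply: contraTneq uB => u'y; rewrite (leaf u); last first.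
        by rewrite -u'y /del_rel /= gsym guu' uD u'D.
      by move: xA; case: (esepP H x).
    rewrite inE u'B u'y !andbT; apply: connect_trans c (connect1 _).
    by apply: contraT => /(small _ _ Fuu')[]; rewrite uB.
  have w1P : w1 \in P.
    rewrite inE connect0 w1y andbT /=.
    move: (cross v w1 vB vy g1) (contraNN (subsetP SD w1) w1D).
    by case: (esepP H w1).
  by move: w1P; rewrite (closed_connect cl c12) => /and3P[].
apply: good => w1 w2 g1 g2 w1D w2D w12 c12.
have [w1y|w1y] := eqVneq w1 y; [right|by left; apply: half].
by apply: half; rewrite // 1?F_sym // -w1y eq_sym.
Qed.

(** Combines the forest identity for F with [sum_deg_split]; the additive form avoids truncated
    subtraction. *)
Lemma edge_count :
  #|edges g| + #|Edeg g k| + cF g k + #|D| = #|T| + k * #|D|.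
Proof.
have sF := del_rel_simple D sg; have sD := del_rel_simple (~: D) sg.
have Fcount : \sum_u deg F u + 2 * n_comp F T = 2 * #|T|.
  apply: (forest_count sF) => X X0; have [y yX c] := exists_leaf sg mkg k0 X0.
  exists y => //; apply: leq_trans c; apply: subset_leq_card; apply/subsetP=> z.
  by rewrite !inE high_edgeE.
(* Deleted vertices remain in [T] as isolated points, each its own component. *)
have comps : n_comp F T = cF g k + #|D|.
  rewrite (n_compC (~: D)) [n_comp F [predC _]]n_comp_isolated //; last first.
    by move=> u w; rewrite !inE negbK /del_rel /= => uD; rewrite inE uD andbF.
  by congr (_ + _); apply: eq_card => u; rewrite !inE negbK.
have ED : edges (del_rel g (~: D)) = Edeg g k.
  apply/setP=> E; rewrite [RHS]inE; apply/imset2P/andP => [[u w _]|[]].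
    rewrite inE /del_rel /= !in_setC !negbK => /andP[/andP[guw uD] wD] ->.
    by split; [apply/imset2P; exists u w; rewrite ?inE | apply/subsetP=> z /set2P[]->].
  case/imset2P=> u w _; rewrite inE /= => guw -> sub.
  exists u w => //; rewrite inE /del_rel /= !in_setC !negbK guw /=.
  by rewrite !(subsetP sub) ?inE ?eqxx ?orbT.
have := sum_deg_split sg D; rewrite (handshake sg) (handshake sD) ED.
have -> : \sum_(x in D) deg g x = k * #|D|.
  rewrite mulnC -sum_nat_const; apply: eq_bigr => x.
  by rewrite inE => /eqP.
move: Fcount comps; clear; lia.
Qed.

End Main.

Unset Implicit Arguments.
Local Open Scope ring_scope.

Theorem mainTheorem2 (T : finType) (g : rel T) (k : nat) :
  simple_graph g -> (2 <= k)%N -> minimally_k_connected g k ->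
  let n := #|T| in
  let m := #|edges g| in
  (#|Vdeg g k|%:R : rat)
    = ((m%:R - n%:R + (cF g k)%:R + #|Edeg g k|%:R) / (k%:R - 1))
  /\ (Num.ceil ((m%:R - n%:R + k%:R) / (k%:R - 1) : rat) <= #|Vdeg g k|%:Z).
Proof.
move=> sg k2 mkg n m.
have k0 : (0 < k)%N by apply: ltnW.
have cnt : m%:R + #|Edeg g k|%:R + (cF g k)%:R + #|Vdeg g k|%:R
    = n%:R + k%:R * #|Vdeg g k|%:R :> rat.
  by rewrite -natrM -!natrD (edge_count sg mkg k0).
have k1 : 0 < k%:R - 1 :> rat by rewrite subr_gt0 ltr1n.
have E : (#|Vdeg g k|%:R : rat)
    = ((m%:R - n%:R + (cF g k)%:R + #|Edeg g k|%:R) / (k%:R - 1)).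
  by apply: (canRL (mulfK (lt0r_neq0 k1))); lra.
split=> //; rewrite ceil_le_int -[_%:~R]pmulrn E ler_pM2r ?invr_gt0 //.
have := bound_cF_Edeg sg mkg k0; rewrite -(ler_nat rat) natrD; lra.
Qed.
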